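(* Every strongly finitary monad $\mathbb{T}$ on $\mathbf{CPO}$ is the free-algebra monad of its associated variety $\mathscr{V}_{\mathbb{T}}$.
   Context: A cpo is a poset with joins of $\omega$-chains; $\mathbf{CPO}$ is the category of cpos and continuous maps (monotone maps preserving joins of $\omega$-chains), cartesian closed with pointwise ordered $[A,B]$. Functors are $\mathbf{CPO}$-enriched, i.e. locally continuous. Let $K:\mathbf{Set}_{fin}\to\mathbf{CPO}$ embed finite sets as finite discrete cpos. An enriched endofunctor $T$ of $\mathbf{CPO}$ is strongly finitary if $T=\mathrm{Lan}_K(T\circ K)$ (enriched left Kan extension); a monad is strongly finitary if its underlying functor is. $|P|$ is the underlying set of $P$. $\Sigma$ is a finitary signature (each symbol has an arity in $\mathbb{N}$), $V=\{x_k\mid k\in\mathbb{N}\}$ a set of variables. A continuous algebra is a cpo $A$ with continuous operations $\sigma_A:A^n\to A$ for each $n$-ary $\sigma\in\Sigma$; $\Sigma\text{-}\mathbf{CPO}$ is the category of continuous algebras and continuous homomorphisms. The set $\mathcal{T}_\Sigma V$ of (extended) terms is the smallest set such that (1) every variable is a term; (2) for $\sigma$ $n$-ary and terms $t_i$ ($i<n$), $\sigma(t_i)_{i<n}$ is a term; (3) every countable collection $t_k$ ($k\in\mathbb{N}$) of terms which all together contain only finitely many variables yields a term (formal join) $\bigvee_{k\in\mathbb{N}}t_k$. For an interpretation $f:V\to A$ the partial function $f^\sharp:\mathcal{T}_\Sigma V\rightharpoonup A$ is: $f^\sharp(x)=f(x)$; $f^\sharp(\sigma(t_i)_{i<n})$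 is defined iff all $f^\sharp(t_i)$ are, and is then $\sigma_A(f^\sharp(t_i))_{i<n}$; $f^\sharp(\bigvee_k t_k)$ is defined iff all $f^\sharp(t_k)$ are defined and $f^\sharp(t_k)\sqsubseteq f^\sharp(t_{k+1})$ for all $k$, and is then $\bigsqcup_k f^\sharp(t_k)$. A variety of continuous algebras is a full subcategory $\mathscr{V}$ of $\Sigma\text{-}\mathbf{CPO}$ presented by a set of equations $t=t'$ between extended terms: $A\in\mathscr{V}$ iff for each of these equations and every $f:V\to A$ both $f^\sharp(t)$ and $f^\sharp(t')$ are defined and equal. The forgetful functor $U_{\mathscr{V}}:\mathscr{V}\to\mathbf{CPO}$ of a variety has a left adjoint $F_{\mathscr{V}}$; the free-algebra monad of $\mathscr{V}$ is the monad of the adjunction $F_{\mathscr{V}}\dashv U_{\mathscr{V}}$. Associated variety. Let $\mathbb{T}=(T,\mu,\eta)$ be a strongly finitary monad on $\mathbf{CPO}$, and for $f:X\to TY$ put $f^*=\mu_Y\circ Tf:TX\to TY$. Let $V_n=\{x_0,\dots,x_{n-1}\}$ as a discrete cpo. The associated signature has $\Sigma_n=|TV_n|$ as the set of $n$-ary symbols ($n\in\mathbb{N}$). Each $n$-ary symbol $\sigma$ is identified with the term $\sigma(x_i)_{i<n}$. The associated variety $\mathscr{V}_{\mathbb{T}}$ is presented by the following equations ($n,m\in\mathbb{N}$): (1) $\sigma=\bigvee_{k\in\mathbb{N}}\sigma_k$ for every $\omega$-chain $(\sigma_k)_{k<\omega}$ in $TV_n$ with $\sigma=\bigsqcup_{k\in\mathbb{N}}\sigma_k$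 in $TV_n$; (2) $u^*(\sigma)=\sigma(u(x_i))_{i<n}$ for every $\sigma\in|TV_n|$ and all maps $u:V_n\to|TV_m|$; (3) $\eta_{V_n}(x_i)=x_i$ for all $i<n$. *)

(* Defs.v *)
From Stdlib Require Import Eqdep_dec.
From mathcomp Require Import all_boot boolp.
Set Implicit Arguments.
Unset Strict Implicit.
Unset Printing Implicit Defensive.

Definition omega_chain (A : Type) (le : A -> A -> Prop) (c : nat -> A) : Prop :=
  forall k, le (c k) (c k.+1).

Definition is_join (A : Type) (le : A -> A -> Prop) (c : nat -> A) (x : A) : Prop :=
  (forall k, le (c k) x) /\ (forall y, (forall k, le (c k) y) -> le x y).

(* The order is Prop-valued: a boolean [porderType] order would be undecidable
   already on the hom-posets below. No least element is required. *)
Record cpo := Cpo {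
  carrier :> Type;
  cle : carrier -> carrier -> Prop;
  cle_refl : forall x, cle x x;
  cle_trans : forall x y z, cle x y -> cle y z -> cle x z;
  cle_anti : forall x y, cle x y -> cle y x -> x = y;
  cpo_complete : forall c, omega_chain cle c -> exists x, is_join cle c x }.

Declare Scope cpo_scope.
Delimit Scope cpo_scope with cpo.
Notation "x ⊑ y" := (cle x y) (at level 70, no associativity) : cpo_scope.
Local Open Scope cpo_scope.

Definition chain (A : cpo) (c : nat -> A) : Prop := omega_chain (@cle A) c.
Definition join_of (A : cpo) (c : nat -> A) (x : A) : Prop := is_join (@cle A) c x.

Lemma join_of_unique (A : cpo) (c : nat -> A) x y :
  join_of c x -> join_of c y -> x = y.
Proof.
by move=> [ux lx] [uy ly]; apply: cle_anti; [apply: lx | apply: ly].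
Qed.

Lemma chain_le (A : cpo) (c : nat -> A) : chain c ->
  forall k l, (k <= l)%N -> c k ⊑ c l.
Proof.
move=> cc k l; elim: l => [|l IH]; first by rewrite leqn0 => /eqP ->; apply: cle_refl.
rewrite leq_eqVlt => /orP [/eqP -> | /IH kl]; first exact: cle_refl.
exact: cle_trans kl (cc l).
Qed.

Lemma le_join_of (A : cpo) (c d : nat -> A) x y :
  (forall k, c k ⊑ d k) -> join_of c x -> join_of d y -> x ⊑ y.
Proof. by move=> cd [_ lx] [uy _]; apply: lx => k; apply: cle_trans (cd k) (uy k). Qed.

Lemma choose_joins (I : Type) (A : cpo) (c : nat -> I -> A) :
  (forall i, chain (fun k => c k i)) ->
  exists x : I -> A, forall i, join_of (fun k => c k i) (x i).
Proof.
move=> cc; exists (fun i => projT1 (cid (cpo_complete (cc i)))) => i.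
exact: projT2 (cid _).
Qed.

Definition continuous (A B : cpo) (f : A -> B) : Prop :=
  (forall x y, x ⊑ y -> f x ⊑ f y) /\
  (forall c x, chain c -> join_of c x -> join_of (fun k => f (c k)) (f x)).

Record cmap (A B : cpo) := Cmap {
  cfun :> A -> B;
  cfun_continuous : continuous cfun }.

Lemma cmap_eq (A B : cpo) (f g : cmap A B) : (forall x, f x = g x) -> f = g.
Proof.
case: f g => f cf [g cg] /= e; have e' : f = g by apply: funext.
by subst g; rewrite (Prop_irrelevance cf cg).
Qed.

Section CpoConstructions.

Lemma discrete_complete (X : Type) (c : nat -> X) :
  omega_chain eq c -> exists x, is_join eq c x.
Proof.
move=> cc; exists (c 0); split=> [k|y uy]; last exact: uy 0.
by elim: k => // k <-; apply/esym/cc.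
Qed.

Definition discrete (X : Type) : cpo :=
  @Cpo X eq (@erefl X) (@etrans X) (fun x y e _ => e) (@discrete_complete X).

Variables (I : Type) (A B : cpo).

Definition pow_le (x y : I -> A) : Prop := forall i, x i ⊑ y i.

Lemma pow_refl x : pow_le x x.
Proof. by move=> i; apply: cle_refl. Qed.

Lemma pow_trans x y z : pow_le x y -> pow_le y z -> pow_le x z.
Proof. by move=> xy yz i; apply: cle_trans (xy i) (yz i). Qed.

Lemma pow_anti x y : pow_le x y -> pow_le y x -> x = y.
Proof. by move=> xy yx; apply: funext => i; apply: cle_anti. Qed.

Lemma pow_is_join c x :
  (forall i, join_of (fun k => c k i) (x i)) -> is_join pow_le c x.
Proof.
move=> jx; split=> [k i|y uy i]; first by case: (jx i).
by case: (jx i) => _; apply=> k; apply: uy.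
Qed.

Lemma pow_complete c : omega_chain pow_le c -> exists x, is_join pow_le c x.
Proof.
move=> cc; have [|x jx] := @choose_joins I A c; first by move=> i k; apply: cc.
by exists x; apply: pow_is_join.
Qed.

Definition power : cpo := Cpo pow_refl pow_trans pow_anti pow_complete.

Definition prod_le (p q : A * B) : Prop := p.1 ⊑ q.1 /\ p.2 ⊑ q.2.

Lemma prod_refl p : prod_le p p.
Proof. by split; apply: cle_refl. Qed.

Lemma prod_trans p q r : prod_le p q -> prod_le q r -> prod_le p r.
Proof. by move=> [a b] [a' b']; split; [apply: cle_trans a' | apply: cle_trans b']. Qed.

Lemma prod_anti p q : prod_le p q -> prod_le q p -> p = q.
Proof.
case: p q => [x y] [x' y'] [/= a b] [/= a' b'].
by rewrite (cle_anti a a') (cle_anti b b').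
Qed.

Lemma prod_is_join c x y :
  join_of (fun k => (c k).1) x -> join_of (fun k => (c k).2) y ->
  is_join prod_le c (x, y).
Proof.
move=> [ux lx] [uy ly]; split=> [k|z uz]; first by split; [apply: ux | apply: uy].
by split; [apply: lx | apply: ly] => k; case: (uz k).
Qed.

Lemma prod_complete c : omega_chain prod_le c -> exists x, is_join prod_le c x.
Proof.
move=> cc.
have [k|x jx] := @cpo_complete A (fun k => (c k).1); first by case: (cc k).
have [k|y jy] := @cpo_complete B (fun k => (c k).2); first by case: (cc k).
by exists (x, y); apply: prod_is_join.
Qed.

Definition prod_cpo : cpo := Cpo prod_refl prod_trans prod_anti prod_complete.

Definition cmap_le (f g : cmap A B) : Prop := forall x, f x ⊑ g x.

Lemma cmap_refl f : cmap_le f f.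
Proof. by move=> x; apply: cle_refl. Qed.

Lemma cmap_trans f g h : cmap_le f g -> cmap_le g h -> cmap_le f h.
Proof. by move=> fg gh x; apply: cle_trans (fg x) (gh x). Qed.

Lemma cmap_anti f g : cmap_le f g -> cmap_le g f -> f = g.
Proof. by move=> fg gf; apply: cmap_eq => x; apply: cle_anti. Qed.

Lemma cmap_is_join (c : nat -> cmap A B) (f : cmap A B) :
  (forall x, join_of (fun k => c k x) (f x)) -> is_join cmap_le c f.
Proof.
move=> jf; split=> [k x|g ug x]; first by case: (jf x).
by case: (jf x) => _; apply=> k; apply: ug.
Qed.

Lemma cmap_pointwise_join (c : nat -> cmap A B) : omega_chain cmap_le c ->
  exists f : cmap A B, forall x, join_of (fun k => c k x) (f x).
Proof.
move=> cc; have [|f jf] := @choose_joins A B (fun k x => c k x).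
  by move=> x k; apply: cc.
suff cf : continuous f by exists (Cmap cf).
have mf : forall x y, x ⊑ y -> f x ⊑ f y.
  move=> x y xy; apply: (le_join_of _ (jf x) (jf y)) => k.
  by case: (cfun_continuous (c k)) => m _; apply: m.
split=> // d x cd jx; split=> [k|y uy]; first by apply: mf; case: jx.
case: (jf x) => _; apply=> l.
case: (cfun_continuous (c l)) => _ /(_ d x cd jx) [_]; apply=> k.
by apply: cle_trans (uy k); case: (jf (d k)).
Qed.

Lemma cmap_complete c : omega_chain cmap_le c -> exists f, is_join cmap_le c f.
Proof.
by move=> /cmap_pointwise_join [f jf]; exists f; apply: cmap_is_join.
Qed.

Definition exp_cpo : cpo := Cpo cmap_refl cmap_trans cmap_anti cmap_complete.

Lemma cmap_join_pointwise (c : nat -> exp_cpo) (f : exp_cpo) :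
  chain c -> join_of c f -> forall x, join_of (fun k => (c k : cmap A B) x) ((f : cmap A B) x).
Proof.
move=> cc jf x; have [g jg] := cmap_pointwise_join cc.
by rewrite (join_of_unique jf (cmap_is_join jg)).
Qed.

End CpoConstructions.

Lemma prod_join_proj (A B : cpo) (c : nat -> prod_cpo A B) (p : prod_cpo A B) :
  chain c -> join_of c p ->
  join_of (fun k => (c k).1) p.1 /\ join_of (fun k => (c k).2) p.2.
Proof.
move=> cc jp.
have [k|x jx] := @cpo_complete A (fun k => (c k).1); first by case: (cc k).
have [k|y jy] := @cpo_complete B (fun k => (c k).2); first by case: (cc k).
by rewrite (join_of_unique jp (prod_is_join jx jy)).
Qed.

Lemma continuous_id (A : cpo) : continuous (fun x : A => x).
Proof. by []. Qed.

Lemma continuous_comp (A B C : cpo) (g : B -> C) (f : A -> B) :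
  continuous g -> continuous f -> continuous (fun x => g (f x)).
Proof.
move=> [mg jg] [mf jf]; split=> [x y xy|c x cc jx]; first by apply/mg/mf.
by apply: jg; [move=> k; apply: mf | apply: jf].
Qed.

Lemma continuous_pair (A B C : cpo) (f : A -> B) (g : A -> C) :
  continuous f -> continuous g ->
  continuous (B := prod_cpo B C) (fun x => (f x, g x)).
Proof.
move=> [mf jf] [mg jg]; split=> [x y xy|c x cc jx].
  by split; [apply: mf | apply: mg].
by apply: prod_is_join; [apply: jf | apply: jg].
Qed.

Lemma continuous_const (A B : cpo) (b : B) : continuous (fun _ : A => b).
Proof.
split=> [x y _|c x _ _]; first exact: cle_refl.
by split=> [_|y]; [apply: cle_refl | apply; exact: 0].
Qed.

Lemma continuous_discrete (X : Type) (A : cpo) (f : X -> A) :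
  continuous (A := discrete X) f.
Proof.
split=> [x y ->|c x _ [ux _]]; first exact: cle_refl.
split=> [k|y uy]; first by rewrite (ux k); apply: cle_refl.
by rewrite -(ux 0); apply: uy.
Qed.

Definition discrete_map (X : Type) (A : cpo) (f : X -> A) : cmap (discrete X) A :=
  Cmap (continuous_discrete f).

Definition cmap_id (A : cpo) : cmap A A := Cmap (@continuous_id A).

Definition cmap_comp (A B C : cpo) (g : cmap B C) (f : cmap A B) : cmap A C :=
  Cmap (continuous_comp (cfun_continuous g) (cfun_continuous f)).

Lemma cmap_comp_continuous (A B C : cpo) :
  continuous (A := prod_cpo (exp_cpo B C) (exp_cpo A B)) (B := exp_cpo A C)
    (fun p => cmap_comp p.1 p.2).
Proof.
have mc : forall p q : prod_cpo (exp_cpo B C) (exp_cpo A B), p ⊑ q ->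
    (cmap_comp p.1 p.2 : exp_cpo A C) ⊑ cmap_comp q.1 q.2.
  move=> [g f] [g' f'] [/= gg ff] x /=; apply: cle_trans (gg _).
  by case: (cfun_continuous g) => m _; apply: m; apply: ff.
split=> // c p cc jp; have [j1 j2] := prod_join_proj cc jp.
have c1 : chain (fun k => (c k).1) by move=> k; case: (cc k).
have c2 : chain (fun k => (c k).2) by move=> k; case: (cc k).
split=> [k|h uh x]; first by apply: mc; case: jp.
have [_ lx] := cmap_join_pointwise c1 j1 ((p.2 : cmap A B) x); apply: lx => k.
have jx := cmap_join_pointwise c2 j2 x.
case: (cfun_continuous (c k).1) => m jj.
have [|_ ly] := jj (fun l => ((c l).2 : cmap A B) x) _ _ jx; first by move=> l; apply: c2.
apply: ly => l; apply: cle_trans (uh (maxn k l) x) => /=.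
have hk : (c k).1 ⊑ (c (maxn k l)).1 by apply: (chain_le c1); apply: leq_maxl.
have hl : (c l).2 ⊑ (c (maxn k l)).2 by apply: (chain_le c2); apply: leq_maxr.
by apply: cle_trans (hk _); apply: m; apply: hl.
Qed.

Record cpo_cat := CpoCat {
  ob :> Type;
  hom : ob -> ob -> cpo;
  idm : forall a, hom a a;
  comp : forall a b c, hom b c -> hom a b -> hom a c;
  comp_continuous : forall a b c,
    continuous (A := prod_cpo (hom b c) (hom a b)) (fun p => comp p.1 p.2);
  compA : forall a b c d (h : hom c d) (g : hom b c) (f : hom a b),
    comp h (comp g f) = comp (comp h g) f;
  comp1m : forall a b (f : hom a b), comp (idm b) f = f;
  compm1 : forall a b (f : hom a b), comp f (idm a) = f }.

Arguments idm {C} a : rename.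
Notation "g ∘ f" := (comp g f) (at level 40, left associativity) : cpo_scope.

Lemma continuous_compl (C : cpo_cat) (a b c : C) (g : hom b c) :
  continuous (fun f : hom a b => g ∘ f).
Proof.
have cp := continuous_pair (continuous_const (hom a b) g) (@continuous_id _).
exact: (continuous_comp (@comp_continuous C a b c) cp).
Qed.

Lemma continuous_compr (C : cpo_cat) (a b c : C) (f : hom a b) :
  continuous (fun g : hom b c => g ∘ f).
Proof.
have cp := continuous_pair (@continuous_id _) (continuous_const (hom b c) f).
exact: (continuous_comp (@comp_continuous C a b c) cp).
Qed.

Definition is_iso (C : cpo_cat) (a b : C) (f : hom a b) : Prop :=
  exists g : hom b a, g ∘ f = idm a /\ f ∘ g = idm b.

Definition CPO : cpo_cat :=
  @CpoCat cpo exp_cpo cmap_id cmap_comp cmap_comp_continuous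
    (fun a b c d h g f => @cmap_eq a d (cmap_comp h (cmap_comp g f))
       (cmap_comp (cmap_comp h g) f) (fun=> erefl))
    (fun a b f => @cmap_eq a b (cmap_comp (cmap_id b) f) f (fun=> erefl))
    (fun a b f => @cmap_eq a b (cmap_comp f (cmap_id a)) f (fun=> erefl)).

Lemma fin_comp_continuous (X Y Z : finType) :
  continuous (A := prod_cpo (discrete (Y -> Z)) (discrete (X -> Y)))
    (B := discrete (X -> Z)) (fun p => p.1 \o p.2).
Proof.
have mc : forall p q : prod_cpo (discrete (Y -> Z)) (discrete (X -> Y)),
    p ⊑ q -> p.1 \o p.2 = q.1 \o q.2 by move=> [g f] [g' f'] [/= -> ->].
split=> // c p cc jp; split=> [k|h uh]; first by apply: mc; case: jp.
by rewrite -(uh 0); apply/esym/mc; case: jp.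
Qed.

Definition SetFin : cpo_cat :=
  @CpoCat finType (fun X Y => discrete (X -> Y)) (fun X => id)
    (fun X Y Z g f => g \o f) fin_comp_continuous
    (fun _ _ _ _ _ _ _ => erefl) (fun _ _ _ => erefl) (fun _ _ _ => erefl).

Lemma op_comp_continuous (C : cpo_cat) (a b c : C) :
  continuous (A := prod_cpo (hom c b) (hom b a)) (B := hom c a)
    (fun p => p.2 ∘ p.1).
Proof.
have cs : continuous (A := prod_cpo (hom c b) (hom b a))
    (B := prod_cpo (hom b a) (hom c b)) (fun p => (p.2, p.1)).
  apply: continuous_pair; split=> [p q [] //|d p cd /(prod_join_proj cd) [] //].
exact: (continuous_comp (@comp_continuous C c b a) cs).
Qed.

Definition op_cat (C : cpo_cat) : cpo_cat :=
  @CpoCat C (fun a b => hom b a) (fun a => idm a) (fun a b c g f => f ∘ g)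
    (@op_comp_continuous C)
    (fun a b c d h g f => esym (compA f g h))
    (fun a b f => compm1 f) (fun a b f => comp1m f).

Definition full_subcat (C : cpo_cat) (P : C -> Prop) : cpo_cat :=
  @CpoCat {a : C | P a} (fun a b => hom (sval a) (sval b)) (fun a => idm (sval a))
    (fun a b c g f => g ∘ f)
    (fun a b c => @comp_continuous C (sval a) (sval b) (sval c))
    (fun a b c d h g f => compA h g f)
    (fun a b f => comp1m f) (fun a b f => compm1 f).

Record functor (C D : cpo_cat) := Functor {
  fob :> C -> D;
  fmap : forall a b, cmap (hom a b) (hom (fob a) (fob b));
  fmap_id : forall a, fmap a a (idm a) = idm (fob a);
  fmap_comp : forall a b c (g : hom b c) (f : hom a b),
    fmap a c (g ∘ f) = fmap b c g ∘ fmap a b f }.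

Arguments fmap {C D} f {a b} : rename.

Definition id_functor (C : cpo_cat) : functor C C :=
  @Functor C C (fun a => a) (fun a b => cmap_id (hom a b))
    (fun _ => erefl) (fun _ _ _ _ _ => erefl).

Lemma functor_comp_id (C D E : cpo_cat) (G : functor D E) (F : functor C D) a :
  cmap_comp (fmap G) (fmap F) (idm a) = idm (G (F a)).
Proof. by rewrite /= !fmap_id. Qed.

Lemma functor_comp_comp (C D E : cpo_cat) (G : functor D E) (F : functor C D)
    a b c (g : hom b c) (f : hom a b) :
  cmap_comp (fmap G) (fmap F) (g ∘ f) =
  cmap_comp (fmap G) (fmap F) g ∘ cmap_comp (fmap G) (fmap F) f.
Proof. by rewrite /= !fmap_comp. Qed.

Definition functor_comp (C D E : cpo_cat) (G : functor D E) (F : functor C D) :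
    functor C E :=
  @Functor C E (fun a => G (F a)) (fun a b => cmap_comp (fmap G) (fmap F))
    (functor_comp_id G F) (@functor_comp_comp _ _ _ G F).

Definition subcat_incl (C : cpo_cat) (P : C -> Prop) : functor (full_subcat P) C :=
  @Functor (full_subcat P) C (fun a => sval a)
    (fun a b => cmap_id (hom (sval a) (sval b)))
    (fun _ => erefl) (fun _ _ _ _ _ => erefl).

(* CPO-naturality is plain naturality, since maps out of a hom-cpo are
   determined by their values on elements. *)
Record nat_trans (C D : cpo_cat) (F G : functor C D) := NatTrans {
  ntc :> forall a, hom (F a) (G a);
  nt_natural : forall a b (f : hom a b), ntc b ∘ fmap F f = fmap G f ∘ ntc a }.

Definition nat_le (C D : cpo_cat) (F G : functor C D) (s t : nat_trans F G) : Prop :=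
  forall a, s a ⊑ t a.

Definition nat_id (C D : cpo_cat) (F : functor C D) : nat_trans F F :=
  @NatTrans C D F F (fun a => idm (F a))
    (fun a b f => etrans (comp1m (fmap F f)) (esym (compm1 (fmap F f)))).

Section HomInto.
Variables (A C : cpo_cat) (K : functor A C) (c : C).

Definition hom_into_map (a b : A) (f : hom b a) :
    exp_cpo (hom (K a) c) (hom (K b) c) :=
  Cmap (@continuous_compr C (K b) (K a) c (fmap K f)).

Lemma hom_into_continuous (a b : A) : continuous (@hom_into_map a b).
Proof.
have ch h : continuous (fun f : hom b a => h ∘ fmap K f : hom (K b) c).
  exact: (continuous_comp (@continuous_compl C (K b) (K a) c h) (cfun_continuous (@fmap _ _ K b a))).
split=> [f g fg h /=|d f cd jf]; first by case: (ch h) => m _; apply: m.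
by apply: cmap_is_join => h /=; case: (ch h) => _; apply.
Qed.

Lemma hom_into_id (a : A) : hom_into_map (idm a) = cmap_id (hom (K a) c).
Proof. by apply: cmap_eq => h /=; rewrite fmap_id compm1. Qed.

Lemma hom_into_comp (a1 a2 a3 : A) (g : hom a3 a2) (f : hom a2 a1) :
  hom_into_map (f ∘ g) = cmap_comp (hom_into_map g) (hom_into_map f).
Proof. by apply: cmap_eq => h /=; rewrite fmap_comp compA. Qed.

Definition hom_into : functor (op_cat A) CPO :=
  @Functor (op_cat A) CPO (fun a => hom (K a) c)
    (fun a b => Cmap (@hom_into_continuous a b))
    hom_into_id (fun a1 a2 a3 g f => hom_into_comp g f).

End HomInto.

Section Kan.
Variables (A B C : cpo_cat) (K : functor A C) (G : functor A B) (L : functor C B).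
Variable phi : nat_trans G (functor_comp L K).

Lemma lan_component_continuous (c : C) (b : B) (g : hom (L c) b) (a : A) :
  continuous (fun h : hom (K a) c => g ∘ (fmap L h ∘ phi a)).
Proof.
have cr := @continuous_compr B (G a) (L (K a)) (L c) (phi a).
have ch := continuous_comp cr (cfun_continuous (@fmap _ _ L (K a) c)).
exact: (continuous_comp (@continuous_compl B (G a) (L c) b g) ch).
Qed.

Definition lan_component (c : C) (b : B) (g : hom (L c) b) (a : A) :
    cmap (hom (K a) c) (hom (G a) b) :=
  Cmap (lan_component_continuous g a).

Lemma lan_natural (c : C) (b : B) (g : hom (L c) b) (a a' : A) (f : hom a' a) :
  cmap_comp (lan_component g a') (hom_into_map K c f) =
  cmap_comp (hom_into_map G b f) (lan_component g a).
Proof.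
apply: cmap_eq => h /=; rewrite fmap_comp -!compA; congr (_ ∘ (_ ∘ _)).
by have /= -> := nt_natural phi f.
Qed.

Definition lan_compare (c : C) (b : B) (g : hom (L c) b) :
    nat_trans (hom_into K c) (hom_into G b) :=
  @NatTrans (op_cat A) CPO (hom_into K c) (hom_into G b)
    (lan_component g) (@lan_natural c b g).

(* (L, phi) is the (pointwise) left Kan extension of G along K: L c is the
   colimit of G weighted by C(K-, c), i.e. the comparison
     B(L c, b) -> [A^op, CPO](C(K-, c), B(G-, b))
   is an isomorphism of cpos. The codomain lives one universe above [cpo], so
   "isomorphism of cpos" is spelled out as "order isomorphism". *)
Definition is_left_kan : Prop := forall (c : C) (b : B),
  bijective (@lan_compare c b) /\
  (forall g g' : hom (L c) b, g ⊑ g' <-> nat_le (lan_compare g) (lan_compare g')).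

End Kan.

Lemma K_map_continuous (X Y : finType) :
  continuous (A := discrete (X -> Y)) (B := exp_cpo (discrete X) (discrete Y))
    (fun f => @discrete_map X (discrete Y) f).
Proof. exact: continuous_discrete. Qed.

Definition K_fin : functor SetFin CPO :=
  @Functor SetFin CPO (fun X : finType => discrete X)
    (fun X Y => Cmap (@K_map_continuous X Y))
    (fun X => @cmap_eq (discrete X) (discrete X) (discrete_map (A := discrete X) id)
       (cmap_id (discrete X)) (fun=> erefl))
    (fun X Y Z g f => @cmap_eq (discrete X) (discrete Z)
       (discrete_map (A := discrete Z) (g \o f))
       (cmap_comp (discrete_map (A := discrete Z) g) (discrete_map (A := discrete Y) f))
       (fun=> erefl)).

(* T = Lan_K (T K), the universal 2-cell being the identity of T K *)
Definition strongly_finitary (T : functor CPO CPO) : Prop :=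
  is_left_kan (K := K_fin) (L := T) (nat_id (functor_comp T K_fin)).

Record monad (C : cpo_cat) := Monad {
  mfun :> functor C C;
  eta : nat_trans (id_functor C) mfun;
  mu : nat_trans (functor_comp mfun mfun) mfun;
  mu_assoc : forall a, (mu a : hom (mfun (mfun a)) (mfun a)) ∘ fmap mfun (mu a) =
    (mu a : hom (mfun (mfun a)) (mfun a)) ∘ mu (mfun a);
  mu_etal : forall a, (mu a : hom (mfun (mfun a)) (mfun a)) ∘ eta (mfun a) = idm (mfun a);
  mu_etar : forall a,
    (mu a : hom (mfun (mfun a)) (mfun a)) ∘ fmap mfun (eta a) = idm (mfun a) }.

Definition monad_iso (C : cpo_cat) (S T : monad C) : Prop :=
  exists r : nat_trans S T,
    [/\ forall a, is_iso (r a),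
        forall a, r a ∘ eta S a = eta T a
      & forall a, r a ∘ mu S a = (mu T a : hom (T (T a)) (T a)) ∘ (fmap T (r a) ∘ r (S a))].

Record left_adjoint (C D : cpo_cat) (U : functor D C) := LeftAdjoint {
  ladj :> functor C D;
  adj_unit : nat_trans (id_functor C) (functor_comp U ladj);
  adj_counit : nat_trans (functor_comp ladj U) (id_functor D);
  triangle_l : forall c : C, adj_counit (ladj c) ∘ fmap ladj (adj_unit c) = idm (ladj c);
  triangle_r : forall d : D, fmap U (adj_counit d) ∘ adj_unit (U d) = idm (U d) }.

Section AdjunctionMonad.
Variables (C D : cpo_cat) (U : functor D C) (F : left_adjoint U).
Let M : functor C C := functor_comp U F.

Definition adj_mu_c (a : C) : hom (M (M a)) (M a) := fmap U (adj_counit F (F a)).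

Lemma adj_mu_natural (a b : C) (f : hom a b) :
  adj_mu_c b ∘ fmap (functor_comp M M) f = fmap M f ∘ adj_mu_c a.
Proof.
rewrite /adj_mu_c /= -!fmap_comp.
by have /= -> := nt_natural (adj_counit F) (fmap F f).
Qed.

Definition adj_mu : nat_trans (functor_comp M M) M := NatTrans adj_mu_natural.

Lemma adj_mu_assoc (a : C) :
  adj_mu_c a ∘ fmap M (adj_mu_c a) = adj_mu_c a ∘ adj_mu_c (M a).
Proof.
rewrite /adj_mu_c /= -!fmap_comp.
by have /= -> := nt_natural (adj_counit F) (adj_counit F (F a)).
Qed.

Lemma adj_mu_etal (a : C) : adj_mu_c a ∘ adj_unit F (M a) = idm (M a).
Proof. exact: (triangle_r F (F a)). Qed.

Lemma adj_mu_etar (a : C) : adj_mu_c a ∘ fmap M (adj_unit F a) = idm (M a).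
Proof. by rewrite /adj_mu_c /= -fmap_comp triangle_l fmap_id. Qed.

Definition adj_monad : monad C :=
  @Monad C M (adj_unit F) adj_mu adj_mu_assoc adj_mu_etal adj_mu_etar.

End AdjunctionMonad.

Definition signature := nat -> Type.

Record algebra (Sg : signature) := Algebra {
  acpo :> cpo;
  aop : forall n, Sg n -> cmap (power 'I_n acpo) acpo }.

Arguments aop {Sg} a {n} s : rename.

Section Homomorphisms.
Variable Sg : signature.

Definition is_hom (A B : algebra Sg) (f : A -> B) : Prop :=
  forall n (s : Sg n) (a : 'I_n -> A), f (aop A s a) = aop B s (fun i => f (a i)).

Record ahom (A B : algebra Sg) := Ahom {
  ahom_map :> cmap A B;
  ahomP : is_hom ahom_map }.

Lemma ahom_eq (A B : algebra Sg) (f g : ahom A B) : (forall x, f x = g x) -> f = g.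
Proof.
case: f g => f hf [g hg] /= /cmap_eq e; subst g.
by rewrite (Prop_irrelevance hf hg).
Qed.

Section HomCpo.
Variables A B : algebra Sg.

Definition ahom_le (f g : ahom A B) : Prop := cmap_le f g.

Lemma ahom_refl f : ahom_le f f.
Proof. exact: cmap_refl. Qed.

Lemma ahom_trans f g h : ahom_le f g -> ahom_le g h -> ahom_le f h.
Proof. exact: cmap_trans. Qed.

Lemma ahom_anti f g : ahom_le f g -> ahom_le g f -> f = g.
Proof. by move=> fg gf; apply: ahom_eq => x; apply: cle_anti. Qed.

Lemma ahom_pointwise_join (c : nat -> ahom A B) : omega_chain ahom_le c ->
  exists f : ahom A B, forall x, join_of (fun k => c k x) (f x).
Proof.
move=> cc; have [f jf] := cmap_pointwise_join (c := fun k => ahom_map (c k)) cc.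
suff hf : is_hom f by exists (Ahom hf).
move=> n s a; apply: join_of_unique (jf _) _.
case: (cfun_continuous (aop B s)) => _
  /(_ (fun k i => c k (a i)) (fun i => f (a i))) jo.
have -> : (fun k => c k (aop A s a)) = (fun k => aop B s (fun i => c k (a i))).
  by apply: funext => k; rewrite ahomP.
by apply: jo; [move=> k i; apply: cc | apply: pow_is_join => i; apply: jf].
Qed.

Lemma ahom_is_join (c : nat -> ahom A B) (f : ahom A B) :
  (forall x, join_of (fun k => c k x) (f x)) -> is_join ahom_le c f.
Proof.
move=> jf; split=> [k x|g ug x]; first by case: (jf x).
by case: (jf x) => _; apply=> k; apply: ug.
Qed.

Lemma ahom_complete c : omega_chain ahom_le c -> exists f, is_join ahom_le c f.
Proof. by move=> /ahom_pointwise_join [f jf]; exists f; apply: ahom_is_join. Qed.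

Definition ahom_cpo : cpo := Cpo ahom_refl ahom_trans ahom_anti ahom_complete.

Lemma ahom_map_continuous :
  continuous (A := ahom_cpo) (B := exp_cpo A B) (fun f => ahom_map f).
Proof.
split=> // c f cc jf; have [g jg] := ahom_pointwise_join cc.
have -> : f = g := join_of_unique jf (ahom_is_join jg).
exact: cmap_is_join.
Qed.

End HomCpo.

Definition ahom_id (A : algebra Sg) : ahom A A :=
  @Ahom A A (cmap_id A) (fun _ _ _ => erefl).

Lemma is_hom_comp (A B C : algebra Sg) (g : ahom B C) (f : ahom A B) :
  is_hom (cmap_comp g f : cmap A C).
Proof. by move=> n s a /=; rewrite !ahomP. Qed.

Definition ahom_comp (A B C : algebra Sg) (g : ahom B C) (f : ahom A B) : ahom A C :=
  Ahom (is_hom_comp g f).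

Lemma ahom_comp_continuous (A B C : algebra Sg) :
  continuous (A := prod_cpo (ahom_cpo B C) (ahom_cpo A B)) (B := ahom_cpo A C)
    (fun p => ahom_comp p.1 p.2).
Proof.
have cp : continuous (A := prod_cpo (ahom_cpo B C) (ahom_cpo A B))
    (B := exp_cpo A C) (fun p => cmap_comp p.1 p.2).
  have c1 : continuous (A := prod_cpo (ahom_cpo B C) (ahom_cpo A B)) (fun p => p.1).
    by split=> [p q [] //|d p cd /(prod_join_proj cd) [] //].
  have c2 : continuous (A := prod_cpo (ahom_cpo B C) (ahom_cpo A B)) (fun p => p.2).
    by split=> [p q [] //|d p cd /(prod_join_proj cd) [] //].
  have cp := continuous_pair (continuous_comp (@ahom_map_continuous B C) c1)
    (continuous_comp (@ahom_map_continuous A B) c2).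
  exact: (continuous_comp (@cmap_comp_continuous A B C) cp).
case: cp => mp jp; split=> [p q /mp //|d p cd /(jp _ _ cd) [ux lx]].
by split=> [k|h uh]; [apply: ux | apply: (lx (ahom_map h)) => k; apply: uh].
Qed.

Definition SigmaCPO : cpo_cat :=
  @CpoCat (algebra Sg) ahom_cpo ahom_id ahom_comp ahom_comp_continuous
    (fun a b c d h g f => @ahom_eq a d (ahom_comp h (ahom_comp g f))
       (ahom_comp (ahom_comp h g) f) (fun=> erefl))
    (fun a b f => @ahom_eq a b (ahom_comp (ahom_id b) f) f (fun=> erefl))
    (fun a b f => @ahom_eq a b (ahom_comp f (ahom_id a)) f (fun=> erefl)).

Definition forget_algebra : functor SigmaCPO CPO :=
  @Functor SigmaCPO CPO (fun A : algebra Sg => acpo A)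
    (fun A B => Cmap (@ahom_map_continuous A B))
    (fun _ => erefl) (fun _ _ _ _ _ => erefl).

End Homomorphisms.

Section Terms.
Variable Sg : signature.

(* Raw terms; the variable x_k is [rvar k]. The side condition on formal joins
   is imposed by [is_term]. *)
Inductive rterm : Type :=
| rvar of nat
| rapp n of Sg n & ('I_n -> rterm)
| rjoin of (nat -> rterm).

Fixpoint occurs (x : nat) (t : rterm) : Prop :=
  match t with
  | rvar y => x = y
  | rapp n _ ts => exists i, occurs x (ts i)
  | rjoin ts => exists k, occurs x (ts k)
  end.

Fixpoint is_term (t : rterm) : Prop :=
  match t with
  | rvar _ => True
  | rapp n _ ts => forall i, is_term (ts i)
  | rjoin ts => (forall k, is_term (ts k)) /\
      exists vs : seq nat, forall k x, occurs x (ts k) -> x \in vs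
  end.

Definition term : Type := {t : rterm | is_term t}.

Definition tvar (k : nat) : term := exist is_term (rvar k) Logic.I.

Definition tapp n (s : Sg n) (ts : 'I_n -> term) : term :=
  exist is_term (rapp s (fun i => sval (ts i))) (fun i => proj2_sig (ts i)).

Definition tjoin (ts : nat -> term)
    (fin : exists vs : seq nat, forall k x, occurs x (sval (ts k)) -> x \in vs) : term :=
  exist is_term (rjoin (fun k => sval (ts k)))
    (conj (fun k => proj2_sig (ts k)) fin).

(* The graph of the partial map f^sharp, so that [interp f t a] reads
   "f^sharp t is defined and equal to a". *)
Inductive interp (A : algebra Sg) (f : nat -> A) : rterm -> A -> Prop :=
| interp_var k : interp f (rvar k) (f k)
| interp_app n (s : Sg n) ts a :
    (forall i, interp f (ts i) (a i)) -> interp f (rapp s ts) (aop A s a)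
| interp_join ts c a :
    (forall k, interp f (ts k) (c k)) -> chain c -> join_of c a ->
    interp f (rjoin ts) a.

Lemma interp_unique (A : algebra Sg) (f : nat -> A) t a b :
  interp f t a -> interp f t b -> a = b.
Proof.
move=> fa; elim: fa b => {t a} [k|n s ts a _ IH|ts c a _ IH _ ja] b fb.
- by inversion fb.
- move: fb; move E: (rapp s ts) => t fb.
  case: fb E => // n' s' ts' a' fa' E.
  case: E => e; subst n'.
  move=> e1 e2; have es := inj_pair2_eq_dec _ (@eq_comparable nat) _ _ _ _ e1.
  have et := inj_pair2_eq_dec _ (@eq_comparable nat) _ _ _ _ e2.
  by subst s' ts'; congr (aop A s _); apply: funext => i; apply: IH.
- move: fb; move E: (rjoin ts) => t fb.
  case: fb E => // ts' c' a' fc _ jb [e]; subst ts'.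
  have e : c = c' by apply: funext => k; apply: IH.
  by subst c'; apply: join_of_unique ja jb.
Qed.

Definition satisfies (A : algebra Sg) (t t' : term) : Prop :=
  forall f : nat -> A, exists a, interp f (sval t) a /\ interp f (sval t') a.

Definition variety (E : term -> term -> Prop) : cpo_cat :=
  full_subcat (C := SigmaCPO Sg) (fun A => forall t t', E t t' -> satisfies A t t').

Definition forget_variety (E : term -> term -> Prop) : functor (variety E) CPO :=
  functor_comp (forget_algebra Sg) (subcat_incl _).

End Terms.

Section Associated.
Variable T : monad CPO.

Definition star (X Y : cpo) (f : hom (X : CPO) (T Y)) : cmap (T X : cpo) (T Y : cpo) :=
  (mu T Y : hom (T (T Y)) (T Y)) ∘ fmap T f.

Definition Vn (n : nat) : cpo := discrete 'I_n.

Definition assoc_sig : signature := fun n => carrier (T (Vn n) : cpo).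

(* an n-ary symbol s seen as the term s(x_0, ..., x_(n-1)) *)
Definition symb n (s : assoc_sig n) : term assoc_sig :=
  tapp s (fun i : 'I_n => tvar assoc_sig i).

Lemma symb_join_finite n (s : nat -> assoc_sig n) :
  exists vs : seq nat, forall k x, occurs x (sval (symb (s k))) -> x \in vs.
Proof.
by exists (iota 0 n) => k x /= [i ->]; rewrite mem_iota ltn_ord.
Qed.

Inductive assoc_eq : term assoc_sig -> term assoc_sig -> Prop :=
| assoc_eq_join n (c : nat -> (T (Vn n) : cpo)) (s : (T (Vn n) : cpo)) :
    chain c -> join_of c s ->
    assoc_eq (symb s) (tjoin (ts := fun k => symb (c k)) (symb_join_finite c))
| assoc_eq_subst n m (s : (T (Vn n) : cpo)) (u : 'I_n -> (T (Vn m) : cpo)) :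
    assoc_eq (symb (star (X := Vn n) (Y := Vn m) (discrete_map u) s : assoc_sig m))
             (tapp (s : assoc_sig n) (fun i => symb (u i)))
| assoc_eq_unit n (i : 'I_n) :
    assoc_eq (symb ((eta T (Vn n) : cmap (Vn n) (T (Vn n) : cpo)) i : assoc_sig n))
             (tvar assoc_sig i).

Definition forget_assoc : functor (variety assoc_eq) CPO := forget_variety assoc_eq.

End Associated.

(* Main.v *)
From mathcomp Require Import all_boot boolp.
Require Import Defs.
Set Implicit Arguments.
Unset Strict Implicit.
Unset Printing Implicit Defensive.
Local Open Scope cpo_scope.

(** Freeness of T X.  An n-ary operation on T X is s(h) = h^*(s), for s in T V_n
    and h : V_n -> T X.  Strong finitarity says that a continuous map out of
    T X amounts to a family of maps out of T V, natural over the finite sets V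
    mapped into X.  This is used in two ways.

    Uniqueness ([eq_on_supported]): continuous maps on T X are determined by
    their values on the elements T a (s) with a : V_n -> X.  Since
    T a (s) = s(eta a), homomorphisms out of T X are determined on the image of
    eta ([model_hom_unique]).

    Existence ([exists_evaluation]): in a member A of the associated variety,
    (s, a) |-> s_A(a) is continuous in s by the equations on chains and natural
    in V_n by the substitution and unit equations.  It is therefore induced by
    a continuous map T A -> A taking T a (s) to s_A(a), the would-be structure
    map of an Eilenberg-Moore algebra.  The main point is that this map is a
    homomorphism ([evaluation_hom]).  When all arguments of the operation come
    from finite sets, they come from one common finite set V_m, and the claim is
    the substitution equation.  The general case follows by applying uniqueness
    to one argument at a time.

    Evaluation is then the counit of an adjunction with unit eta.  At T X it
    agrees with mu, both being homomorphisms extending the identity, so the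
    monad of this adjunction is T itself; any other left adjoint induces an
    isomorphic monad ([adj_monad_unique]). *)

(** * Continuity in powers of a cpo *)

Lemma discrete_map_continuous (X : Type) (A : cpo) :
  continuous (A := power X A) (B := exp_cpo (discrete X) A)
    (fun h => discrete_map h).
Proof.
split=> // c h _ [uh lh]; split=> [k x|g ug x]; first exact: uh.
by have := lh (fun x => (g : cmap _ _) x); apply=> k y; apply: ug.
Qed.

Lemma power_join_pointwise (X : Type) (A : cpo) (c : nat -> power X A) (h : power X A) :
  chain c -> join_of c h -> forall x, join_of (fun k => c k x) (h x).
Proof.
move=> cc jh x; have [|g jg] := @choose_joins X A c; first by move=> i k; apply: cc.
by rewrite (join_of_unique jh (pow_is_join jg)).
Qed.

Lemma continuous_update (I : eqType) (A : cpo) (h : I -> A) (i0 : I) :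
  continuous (B := power I A) (fun x => fun i => if i == i0 then x else h i).
Proof.
split=> [x y xy i /=|c x cc jx]; first by case: eqP => // _; apply: cle_refl.
apply: pow_is_join => i; case: eqP => // _.
exact: (continuous_const A (h i)).2 cc jx.
Qed.

(** * Maps out of a strongly finitary functor *)

Section Density.
Variables (L : functor CPO CPO) (hL : strongly_finitary L).

Definition lmap (X Y : cpo) (f : cmap X Y) : cmap (L X : cpo) (L Y : cpo) := fmap L f.

Lemma lmap_comp X Y Z (g : cmap Y Z) (f : cmap X Y) s :
  lmap (cmap_comp g f) s = lmap g (lmap f s).
Proof. by rewrite /lmap (fmap_comp L (g : hom (Y : CPO) Z) f). Qed.

Lemma lmap_id X s : lmap (cmap_id X) s = s.
Proof. by rewrite /lmap (fmap_id L X). Qed.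

Definition finitely_supported (c : cpo) (x : (L c : cpo)) : Prop :=
  exists n (a : 'I_n -> c) (s : (L (Vn n) : cpo)), x = lmap (discrete_map a) s.

Lemma supported_lmap (X : finType) (c : cpo) (h : cmap (discrete X) c) s :
  finitely_supported (lmap h s).
Proof.
exists #|X|, (fun i => h (enum_val i)),
  (lmap (discrete_map (A := Vn #|X|) enum_rank) s).
rewrite -lmap_comp; congr (lmap _ s).
by apply: cmap_eq => x /=; rewrite enum_rankK.
Qed.

(** The Kan comparison sends a map on L c to its restrictions along all
    L h with h defined on a finite set, and it reflects the order. *)
Lemma le_on_supported (c b : cpo) (g g' : cmap (L c : cpo) b) :
  (forall x, finitely_supported x -> g x ⊑ g' x) -> forall x, g x ⊑ g' x.
Proof.
move=> le_gg'; have [_ emb] := hL c b.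
suff : (g : exp_cpo (L c) b) ⊑ g' by [].
by apply/emb => X h s; apply: le_gg'; apply: supported_lmap.
Qed.

Lemma eq_on_supported (c b : cpo) (g g' : cmap (L c : cpo) b) :
  (forall x, finitely_supported x -> g x = g' x) -> forall x, g x = g' x.
Proof.
move=> e x; apply: cle_anti; apply: le_on_supported => y /e ->; exact: cle_refl.
Qed.

(** The supported arguments are replaced by arbitrary ones coordinate by
    coordinate; with the other coordinates fixed, the one-variable case applies. *)
Lemma eq_on_supported_power (I : finType) (c b : cpo)
    (p q : cmap (power I (L c)) b) :
  (forall h, (forall i, finitely_supported (h i)) -> p h = q h) ->
  forall h, p h = q h.
Proof.
move=> e h.
suff H : forall r : seq I, forall h : power I (L c),
    (forall i, i \notin r -> finitely_supported (h i)) -> p h = q h.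
  by apply: (H (enum I)) => i; rewrite mem_enum.
(* r lists the coordinates already allowed to be arbitrary *)
elim=> [|i0 r IH] {}h hr; first by apply: e => i; apply: hr.
pose upd := Cmap (continuous_update h i0).
have -> : h = upd (h i0) by apply: funext => i /=; case: eqP => // ->.
apply: (@eq_on_supported _ _ (cmap_comp p upd) (cmap_comp q upd)) => x fx /=.
apply: IH => i ir; case: eqP => // /eqP ne.
by apply: hr; rewrite in_cons negb_or ne.
Qed.

(** The disjoint union of the finite sets supporting the h i supports them all. *)
Lemma common_support (c : cpo) n (h : 'I_n -> (L c : cpo)) :
  (forall i, finitely_supported (h i)) ->
  exists m (a : 'I_m -> c) (u : 'I_n -> (L (Vn m) : cpo)),
    forall i, h i = lmap (discrete_map a) (u i).
Proof.
move=> fh.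
pose m i := projT1 (cid (fh i)).
have [a ha] : exists a : forall i, 'I_(m i) -> c, forall i,
    exists s, h i = lmap (discrete_map (a i)) s.
  exists (fun i => projT1 (cid (projT2 (cid (fh i))))) => i.
  exact: projT2 (cid (projT2 (cid (fh i)))).
pose X : finType := {i : 'I_n & 'I_(m i)}.
pose b (x : X) : c := a (tag x) (tagged x).
exists #|X|, (fun k => b (enum_val k)).
pose e i : cmap (Vn (m i)) (Vn #|X|) :=
  discrete_map (A := Vn #|X|) (fun j => enum_rank (Tagged (fun i => 'I_(m i)) j : X)).
exists (fun i => lmap (e i) (projT1 (cid (ha i)))) => i.
rewrite -lmap_comp {1}(projT2 (cid (ha i))); congr (lmap _ _).
by apply: cmap_eq => j /=; rewrite enum_rankK.
Qed.

End Density.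

(** * The Kleisli calculus and the algebras T X *)

Section Kleisli.
Variable T : monad CPO.

Definition ret (X : cpo) : cmap X (T X : cpo) := eta T X.
Definition mult (X : cpo) : cmap (T (T X) : cpo) (T X : cpo) := mu T X.

Lemma ret_natural (X Y : cpo) (f : cmap X Y) x : ret Y (f x) = lmap T f (ret X x).
Proof.
exact: (f_equal (fun g : cmap _ _ => g x) (nt_natural (eta T) (f : hom (X : CPO) Y))).
Qed.

Lemma mult_natural (X Y : cpo) (f : cmap X Y) x :
  mult Y (lmap T (lmap T f) x) = lmap T f (mult X x).
Proof.
exact: (f_equal (fun g : cmap _ _ => g x) (nt_natural (mu T) (f : hom (X : CPO) Y))).
Qed.

Lemma mult_assoc (X : cpo) x : mult X (lmap T (mult X) x) = mult X (mult (T X) x).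
Proof. exact: (f_equal (fun g : cmap _ _ => g x) (mu_assoc T X)). Qed.

Lemma mult_retl (X : cpo) x : mult X (ret (T X) x) = x.
Proof. exact: (f_equal (fun g : cmap _ _ => g x) (mu_etal T X)). Qed.

Lemma mult_retr (X : cpo) x : mult X (lmap T (ret X) x) = x.
Proof. exact: (f_equal (fun g : cmap _ _ => g x) (mu_etar T X)). Qed.

Lemma starE (X Y : cpo) (f : cmap X (T Y)) s : star f s = mult Y (lmap T f s).
Proof. by []. Qed.

Lemma star_ret (X Y : cpo) (f : cmap X (T Y)) x : star f (ret X x) = f x.
Proof. by rewrite starE -ret_natural mult_retl. Qed.

Lemma star_star (X Y Z : cpo) (g : cmap Y (T Z)) (f : cmap X (T Y)) s :
  star g (star f s) = star (cmap_comp (star g) f) s.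
Proof.
rewrite !starE -(mult_natural g) -mult_assoc -!lmap_comp.
by congr (mult _ (lmap T _ s)); apply: cmap_eq.
Qed.

Lemma lmap_star (X Y Z : cpo) (g : cmap Y Z) (f : cmap X (T Y)) s :
  lmap T g (star f s) = star (cmap_comp (lmap T g) f) s.
Proof. by rewrite !starE -mult_natural lmap_comp. Qed.

Lemma lmapE (X Y : cpo) (f : cmap X Y) s : lmap T f s = star (cmap_comp (ret Y) f) s.
Proof. by rewrite starE lmap_comp mult_retr. Qed.

Lemma star_continuous n (X : cpo) (s : (T (Vn n) : cpo)) :
  continuous (A := power 'I_n (T X)) (B := T X)
    (fun h => star (X := Vn n) (Y := X) (discrete_map h) s).
Proof.
have ce : continuous (A := exp_cpo (T (Vn n)) (T (T X))) (B := T X)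
    (fun g => mult X ((g : cmap _ _) s)).
  apply: continuous_comp (cfun_continuous (mult X)) _.
  by split=> [f g /(_ s) //|c f cc /(cmap_join_pointwise cc) /(_ s)].
have cf := continuous_comp (cfun_continuous (@fmap _ _ T (Vn n : CPO) (T X)))
  (@discrete_map_continuous 'I_n (T X)).
exact: (continuous_comp ce cf).
Qed.

Definition free_alg (X : cpo) : algebra (assoc_sig T) :=
  @Algebra (assoc_sig T) (T X) (fun n s => Cmap (@star_continuous n X s)).

Lemma free_algE (X : cpo) n (s : assoc_sig T n) h :
  aop (free_alg X) s h = star (X := Vn n) (Y := X) (discrete_map h) s.
Proof. by []. Qed.

(** This turns agreement on finitely supported elements into agreement on
    generators: a finitely supported element is an operation applied to
    generators. *)
Lemma free_alg_lmap (X : cpo) n (a : 'I_n -> X) (s : assoc_sig T n) :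
  lmap T (discrete_map a) s = aop (free_alg X) s (fun i => ret X (a i)).
Proof. by rewrite free_algE lmapE; congr (star _ s); apply: cmap_eq. Qed.

Lemma interp_symb (A : algebra (assoc_sig T)) (f : nat -> A) n (s : assoc_sig T n) :
  interp f (sval (symb s)) (aop A s (fun i => f i)).
Proof. by apply: interp_app => i; apply: interp_var. Qed.

(** Interpreting a symbol s under f gives f^*(s), so the three families of
    equations express continuity of f^*, associativity of Kleisli extension, and
    f^* eta = f. *)
Lemma free_alg_variety (X : cpo) t t' : assoc_eq t t' -> satisfies (free_alg X) t t'.
Proof.
case=> {t t'} [n c s cc js|n m s u|n i] f.
- exists (aop (free_alg X) s (fun i => f i)); split; first exact: interp_symb.
  have [ms js'] := cfun_continuous (star (X := Vn n) (Y := X) (discrete_map (fun i : 'I_n => f i))).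
  apply: (interp_join (A := free_alg X) (fun k => interp_symb f (c k))).
    by move=> k; apply: ms.
  exact: js'.
- pose a : 'I_n -> free_alg X := fun i => aop (free_alg X) (u i) (fun j => f j).
  exists (aop (free_alg X) s a); split; last first.
    by apply: interp_app => i; apply: interp_symb.
  suff -> : aop (free_alg X) s a =
    aop (free_alg X) (star (X := Vn n) (Y := Vn m) (discrete_map u) s : assoc_sig T m) (fun j => f j).
    exact: interp_symb.
  by rewrite !free_algE star_star; congr (star _ s); apply: cmap_eq.
- exists (f i); split; last exact: interp_var.
  suff -> : f i = aop (free_alg X) (ret (Vn n) i : assoc_sig T n) (fun j => f j).
    exact: interp_symb.
  by rewrite free_algE star_ret.
Qed.

End Kleisli.

(** * Evaluation in a member of the associated variety *)

Section Models.
Variables (T : monad CPO) (A : algebra (assoc_sig T)).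
Hypothesis hA : forall t t', assoc_eq t t' -> satisfies A t t'.

(** Satisfaction quantifies over interpretations of all variables, so a
    valuation of the first n ones needs a default value.  One is always at hand
    below, even for n = 0: the value of the operation under consideration, or one
    of its arguments. *)
Definition extend n (a : 'I_n -> A) (x0 : A) (k : nat) : A :=
  if insub k is Some i then a i else x0.

Lemma extendE n (a : 'I_n -> A) x0 (i : 'I_n) : extend a x0 i = a i.
Proof. by rewrite /extend valK. Qed.

Lemma interp_extendE n (a : 'I_n -> A) x0 (s : assoc_sig T n) :
  interp (extend a x0) (sval (symb s)) (aop A s a).
Proof.
have := interp_symb (extend a x0) s.
by congr (interp _ _ (aop A s _)); apply: funext => i; apply: extendE.
Qed.

Lemma interp_extend n (a : 'I_n -> A) x0 (s : assoc_sig T n) b :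
  interp (extend a x0) (sval (symb s)) b -> b = aop A s a.
Proof. by move=> e; apply: interp_unique e (interp_extendE a x0 s). Qed.

Lemma aop_star n m (s : assoc_sig T n) (u : 'I_n -> assoc_sig T m) (a : 'I_m -> A) :
  aop A (star (X := Vn n) (Y := Vn m) (discrete_map u) s : assoc_sig T m) a =
  aop A s (fun i => aop A (u i) a).
Proof.
set t : assoc_sig T m := star _ s.
have [b [/interp_extend -> e]] := hA (assoc_eq_subst s u) (extend a (aop A t a)).
by apply: interp_unique e _; apply: interp_app => i; apply: interp_extendE.
Qed.

Lemma aop_ret n (i : 'I_n) (a : 'I_n -> A) :
  aop A (ret T (Vn n) i : assoc_sig T n) a = a i.
Proof.
have [b [/interp_extend <- e]] := hA (assoc_eq_unit T i) (extend a (a i)).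
apply: interp_unique e _; rewrite -[X in interp _ _ X](extendE a (a i)).
exact: interp_var.
Qed.

Lemma aop_join n (c : nat -> assoc_sig T n) (s : assoc_sig T n) (a : 'I_n -> A) :
  chain (A := T (Vn n)) c -> join_of (A := T (Vn n)) c s ->
  chain (fun k => aop A (c k) a) /\ join_of (fun k => aop A (c k) a) (aop A s a).
Proof.
move=> cc js.
have [b [/interp_extend -> e]] := hA (assoc_eq_join cc js) (extend a (aop A s a)).
inversion e as [| |ts d x hd cd jd]; subst.
have -> : (fun k => aop A (c k) a) = d.
  by apply: funext => k; rewrite (interp_extend (hd k)).
by [].
Qed.

(** Monotonicity is the chain equation for s, t, t, and so on, whose join is t. *)
Lemma aop_continuous_symbol n (a : 'I_n -> A) :
  continuous (A := T (Vn n)) (fun s => aop A (s : assoc_sig T n) a).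
Proof.
split=> [s t st|c s cc js]; last by case: (aop_join a cc js).
pose c k : (T (Vn n) : cpo) := if k is 0 then s else t.
have cc : chain c by case=> [|k] //=; apply: cle_refl.
have jc : join_of c t.
  by split=> [[|k] //=|y uy]; [apply: cle_refl | apply: (uy 1)].
by have [/(_ 0)] := aop_join a cc jc.
Qed.

(** Renaming of variables is the substitution of the variables eta(x_(u i)). *)
Lemma aop_lmap n m (s : assoc_sig T n) (u : 'I_n -> 'I_m) (a : 'I_m -> A) :
  aop A (lmap T (discrete_map (A := Vn m) u) s : assoc_sig T m) a =
  aop A s (fun i => a (u i)).
Proof.
have -> : lmap T (discrete_map (A := Vn m) u) s =
    star (X := Vn n) (Y := Vn m) (discrete_map (fun i => ret T (Vn m) (u i))) s.
  by rewrite lmapE; congr (star _ s); apply: cmap_eq.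
by rewrite aop_star; congr (aop A s _); apply: funext => i; apply: aop_ret.
Qed.

(** Strong finitarity speaks of all finite sets, the signature only of the sets
    V_n: a finite set is replaced by its enumeration, and [aop_lmap] makes the
    result independent of it. *)
Definition enum_rank_map (X : finType) : cmap (discrete X) (Vn #|X|) :=
  discrete_map (A := Vn #|X|) enum_rank.

Lemma symbol_action_continuous (X : finType) (h : cmap (discrete X) A) :
  continuous (A := T (discrete X)) (B := A)
    (fun s => aop A (lmap T (enum_rank_map X) s : assoc_sig T #|X|)
                (fun i => h (enum_val i))).
Proof.
exact: (continuous_comp (aop_continuous_symbol _) (cfun_continuous (lmap T _))).
Qed.

Lemma action_family_continuous (X : finType) :
  continuous (A := exp_cpo (discrete X) A) (B := exp_cpo (T (discrete X)) A)
    (fun h => Cmap (symbol_action_continuous h)).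
Proof.
have cv s : continuous (A := exp_cpo (discrete X) A) (B := A)
    (fun h => Cmap (symbol_action_continuous h) s).
  apply: (continuous_comp (cfun_continuous (aop A _))).
  split=> [f g fg i|c f cc jf]; first exact: fg.
  by apply: pow_is_join => i; apply: (cmap_join_pointwise cc jf).
split=> [f g fg s|c f cc jf]; first exact: (cv s).1.
by apply: cmap_is_join => s; apply: (cv s).2.
Qed.

Definition action_family (X : finType) :
    cmap (exp_cpo (discrete X) A) (exp_cpo (T (discrete X)) A) :=
  Cmap (@action_family_continuous X).

Lemma action_family_natural (X Y : finType) (f : Y -> X) :
  cmap_comp (action_family Y) (hom_into_map K_fin (A : CPO) (f : hom (Y : SetFin) X)) =
  cmap_comp (hom_into_map (functor_comp T K_fin) (A : CPO) (f : hom (Y : SetFin) X))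
    (action_family X).
Proof.
apply: cmap_eq => h; apply: cmap_eq => s.
change (aop A (lmap T (enum_rank_map Y) s : assoc_sig T #|Y|)
          (fun i => h (f (enum_val i))) =
        aop A (lmap T (enum_rank_map X)
                 (lmap T (discrete_map (A := discrete X) f) s) : assoc_sig T #|X|)
          (fun i => h (enum_val i))).
rewrite -lmap_comp.
have -> : cmap_comp (enum_rank_map X) (discrete_map (A := discrete X) f) =
    cmap_comp (discrete_map (A := Vn #|X|) (fun i => enum_rank (f (enum_val i))))
      (enum_rank_map Y) by apply: cmap_eq => y /=; rewrite enum_rankK.
rewrite lmap_comp aop_lmap.
by congr (aop A _ _); apply: funext => i; rewrite enum_rankK.
Qed.

Definition action_nat : nat_trans (hom_into K_fin (A : CPO))
    (hom_into (functor_comp T K_fin) (A : CPO)) :=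
  @NatTrans (op_cat SetFin) CPO (hom_into K_fin (A : CPO))
    (hom_into (functor_comp T K_fin) (A : CPO)) action_family
    (fun X Y f => @action_family_natural X Y f).

Hypothesis hT : strongly_finitary T.

(** The action of symbols is a cone under the colimit presenting T A; evaluation
    is the induced map, obtained from surjectivity of the Kan comparison. *)
Lemma exists_evaluation : exists g : cmap (T A) A,
  forall n (a : 'I_n -> A) (s : assoc_sig T n), g (lmap T (discrete_map a) s) = aop A s a.
Proof.
have [[k _ kK] _] := hT A A; exists (k action_nat) => n a s.
have /(f_equal (fun t : nat_trans (hom_into K_fin (A : CPO))
    (hom_into (functor_comp T K_fin) (A : CPO)) => ntc t ('I_n : finType))) /=
  /(f_equal (fun t : cmap (exp_cpo (Vn n) A) (exp_cpo (T (Vn n)) A) =>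
    (t (discrete_map a) : cmap _ _) s)) /= e := kK action_nat.
apply: etrans e _.
rewrite aop_lmap; congr (aop A s _); apply: funext => i.
by rewrite enum_rankK.
Qed.

Definition evaluation : cmap (T A) A := projT1 (cid exists_evaluation).

Lemma evaluationE n (a : 'I_n -> A) (s : assoc_sig T n) :
  evaluation (lmap T (discrete_map a) s) = aop A s a.
Proof. exact: (projT2 (cid exists_evaluation) n a s). Qed.

Lemma evaluation_ret x : evaluation (ret T A x) = x.
Proof.
have -> : ret T A x = lmap T (discrete_map (fun _ : 'I_1 => x)) (ret T (Vn 1) ord0).
  by rewrite -ret_natural.
by rewrite evaluationE aop_ret.
Qed.

(** Both sides are continuous in the arguments, so these may be taken supported
    on a common finite set: h i = T a (u i) with a : V_m -> A.  Then both sides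
    are the operation u^*(s) at a, by the substitution equation. *)
Lemma evaluation_hom : is_hom (A := free_alg T A) (B := A) evaluation.
Proof.
move=> n s.
have cq : continuous (A := power 'I_n (T A)) (fun h => aop A s (fun i => evaluation (h i))).
  apply: (continuous_comp (cfun_continuous (aop A s))).
  split=> [f g fg i|c f cc jf]; first exact: (cfun_continuous evaluation).1.
  apply: pow_is_join => i; apply: (cfun_continuous evaluation).2.
    by move=> k; apply: cc.
  exact: power_join_pointwise.
apply: (@eq_on_supported_power _ hT _ _ _ (cmap_comp evaluation (aop (free_alg T A) s)) (Cmap cq)).
move=> h fh; have [m [a [u hu]]] := common_support fh.
have -> : h = fun i => lmap T (discrete_map a) (u i) by apply: funext.
change (evaluation (star (X := Vn n) (Y := A)
  (discrete_map (fun i => lmap T (discrete_map a) (u i))) s) =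
  aop A s (fun i => evaluation (lmap T (discrete_map a) (u i)))).
have -> : star (X := Vn n) (Y := A) (discrete_map (fun i => lmap T (discrete_map a) (u i))) s =
    lmap T (discrete_map a) (star (X := Vn n) (Y := Vn m) (discrete_map u) s).
  by rewrite lmap_star; congr (star _ s); apply: cmap_eq.
rewrite evaluationE aop_star; congr (aop A s _); apply: funext => i.
by rewrite evaluationE.
Qed.

End Models.

(** * The adjunction whose monad is T *)

Section FreeAlgebras.
Variables (T : monad CPO) (hT : strongly_finitary T).

Definition model : cpo_cat := variety (@assoc_eq T).

Definition free_model (X : cpo) : model := exist _ (free_alg T X) (@free_alg_variety T X).

Lemma model_hom_unique (X : cpo) (B : algebra (assoc_sig T)) (g g' : ahom (free_alg T X) B) :
  (forall x, g (ret T X x) = g' (ret T X x)) -> g = g'.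
Proof.
move=> e; apply: ahom_eq; apply: (eq_on_supported hT) => _ [n [a [s ->]]].
rewrite free_alg_lmap (ahomP g) (ahomP g').
by congr (aop B s _); apply: funext => i; apply: e.
Qed.

Lemma lmap_hom (X Y : cpo) (f : cmap X Y) :
  is_hom (A := free_alg T X) (B := free_alg T Y) (lmap T f).
Proof.
by move=> n s h; rewrite !free_algE lmap_star; congr (star _ s); apply: cmap_eq.
Qed.

Definition free_hom (X Y : cpo) (f : cmap X Y) : ahom (free_alg T X) (free_alg T Y) :=
  Ahom (lmap_hom f).

Lemma free_hom_continuous (X Y : cpo) :
  continuous (A := exp_cpo X Y) (B := ahom_cpo (free_alg T X) (free_alg T Y))
    (@free_hom X Y).
Proof.
have [mT jT] := cfun_continuous (@fmap _ _ T (X : CPO) Y).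
split=> [f g /mT //|c f cc jf]; apply: ahom_is_join => x.
apply: (cmap_join_pointwise (c := fun k => lmap T (c k)) _ (jT _ _ cc jf)).
by move=> k; apply: mT.
Qed.

Definition free_functor : functor CPO model :=
  @Functor CPO model free_model (fun X Y => Cmap (@free_hom_continuous X Y))
    (fun X => @ahom_eq _ (free_alg T X) (free_alg T X) (free_hom (cmap_id X))
       (ahom_id _) (@lmap_id T X))
    (fun X Y Z g f => @ahom_eq _ (free_alg T X) (free_alg T Z)
       (free_hom (cmap_comp g f)) (ahom_comp (free_hom g) (free_hom f))
       (@lmap_comp T X Y Z g f)).

Definition free_unit :
    nat_trans (id_functor CPO) (functor_comp (forget_assoc T) free_functor) :=
  @NatTrans CPO CPO (id_functor CPO) (functor_comp (forget_assoc T) free_functor)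
    (ret T) (fun X Y f => nt_natural (eta T) f).

Definition counit (A : model) : ahom (free_alg T (acpo (sval A))) (sval A) :=
  Ahom (evaluation_hom (proj2_sig A) hT).

Lemma counit_ret (A : model) x : counit A (ret T (acpo (sval A)) x) = x.
Proof. exact: evaluation_ret. Qed.

Lemma counit_natural (A B : model) (f : ahom (sval A) (sval B)) :
  ahom_comp (counit B) (free_hom f) = ahom_comp f (counit A).
Proof.
apply: model_hom_unique => x.
rewrite [LHS]/= -ret_natural [RHS]/=.
by rewrite (@counit_ret A) (@counit_ret B).
Qed.

Definition free_counit :
    nat_trans (functor_comp free_functor (forget_assoc T)) (id_functor model) :=
  @NatTrans model model (functor_comp free_functor (forget_assoc T))
    (id_functor model) counit (fun A B f => @counit_natural A B f).

Lemma mult_hom (X : cpo) :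
  is_hom (A := free_alg T (T X)) (B := free_alg T X) (mult T X).
Proof.
move=> n s h; rewrite !free_algE !starE -mult_assoc -lmap_comp.
by congr (mult _ _ (lmap T _ s)); apply: cmap_eq.
Qed.

(** The free algebras are evaluated by mu, as both sides are homomorphisms that
    extend the identity of T X. *)
Lemma counit_free (X : cpo) : counit (free_model X) = Ahom (@mult_hom X).
Proof.
apply: model_hom_unique => x.
by rewrite (@counit_ret (free_model X)) /= mult_retl.
Qed.

Lemma free_triangle_l (X : cpo) :
  ahom_comp (counit (free_model X)) (free_hom (ret T X)) = ahom_id (free_alg T X).
Proof.
apply: model_hom_unique => x; rewrite [LHS]/= -ret_natural.
exact: (@counit_ret (free_model X)).
Qed.

Lemma free_triangle_r (A : model) :
  cmap_comp (counit A) (ret T (acpo (sval A))) = cmap_id (acpo (sval A)).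
Proof. by apply: cmap_eq => x; apply: (@counit_ret A). Qed.

Definition free_left_adjoint : left_adjoint (forget_assoc T) :=
  @LeftAdjoint CPO model (forget_assoc T) free_functor free_unit free_counit
    free_triangle_l free_triangle_r.

End FreeAlgebras.

(** * Uniqueness of the monad of a right adjoint *)

Section AdjointUniqueness.
Variables (C D : cpo_cat) (U : functor D C).

(** Transposition along the adjunction is injective; every identity below between
    maps out of F a is checked on the unit through this. *)
Lemma adj_unit_epi (F : left_adjoint U) (a : C) (b : D) (k k' : hom (F a) b) :
  fmap U k ∘ adj_unit F a = fmap U k' ∘ adj_unit F a -> k = k'.
Proof.
have tr (l : hom (F a) b) :
    adj_counit F b ∘ fmap F (fmap U l ∘ adj_unit F a) = l.
  rewrite fmap_comp compA.
  have /= -> := nt_natural (adj_counit F) l.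
  by rewrite -compA triangle_l compm1.
by move=> e; rewrite -(tr k) e tr.
Qed.

Lemma adj_unit_natural (F : left_adjoint U) (a b : C) (f : hom a b) :
  fmap U (fmap F f) ∘ adj_unit F a = adj_unit F b ∘ f.
Proof. by have /= -> := nt_natural (adj_unit F) f. Qed.

Definition adj_compare (F G : left_adjoint U) (a : C) : hom (F a) (G a) :=
  adj_counit F (G a) ∘ fmap F (adj_unit G a).

Lemma adj_compare_unit (F G : left_adjoint U) (a : C) :
  fmap U (adj_compare F G a) ∘ adj_unit F a = adj_unit G a.
Proof.
by rewrite fmap_comp -compA adj_unit_natural compA triangle_r comp1m.
Qed.

Lemma adj_compareK (F G : left_adjoint U) (a : C) :
  adj_compare G F a ∘ adj_compare F G a = idm (F a).
Proof.
by apply: adj_unit_epi; rewrite fmap_comp -compA !adj_compare_unit fmap_id comp1m.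
Qed.

Lemma adj_compare_natural (F G : left_adjoint U) (a b : C) (f : hom a b) :
  fmap U (adj_compare F G b) ∘ fmap U (fmap F f) =
  fmap U (fmap G f) ∘ fmap U (adj_compare F G a).
Proof.
rewrite -!fmap_comp; congr (fmap U _); apply: adj_unit_epi.
rewrite [in LHS]fmap_comp [in RHS]fmap_comp -!compA adj_compare_unit.
by rewrite !adj_unit_natural compA adj_compare_unit.
Qed.

Lemma adj_compare_mu (F G : left_adjoint U) (a : C) :
  fmap U (adj_compare F G a) ∘ adj_mu_c F a =
  adj_mu_c G a ∘
    (fmap U (fmap G (fmap U (adj_compare F G a))) ∘
     fmap U (adj_compare F G (U (F a)))).
Proof.
rewrite /adj_mu_c /= -!fmap_comp; congr (fmap U _); apply: adj_unit_epi.
rewrite [in LHS]fmap_comp [in RHS]fmap_comp [in RHS]fmap_comp.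
rewrite -!compA adj_compare_unit adj_unit_natural.
by rewrite triangle_r compA triangle_r comp1m compm1.
Qed.

Lemma adj_monad_unique (F G : left_adjoint U) : monad_iso (adj_monad F) (adj_monad G).
Proof.
pose r := @NatTrans C C (adj_monad F) (adj_monad G)
  (fun a => fmap U (adj_compare F G a)) (@adj_compare_natural F G).
exists r; split=> a.
- exists (fmap U (adj_compare G F a)).
  by split; rewrite /= -fmap_comp adj_compareK fmap_id.
- exact: adj_compare_unit.
- exact: adj_compare_mu.
Qed.

End AdjointUniqueness.

Theorem theorem8p4 (T : monad CPO) (hT : strongly_finitary T) :
  inhabited (left_adjoint (forget_assoc T)) /\
  forall F : left_adjoint (forget_assoc T), monad_iso (adj_monad F) T.
Proof.
split=> [|F]; first exact: inhabits (free_left_adjoint hT).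
have [r [iso_r r_unit r_mult]] := adj_monad_unique F (free_left_adjoint hT).
exists (@NatTrans CPO CPO (adj_monad F) T r (fun X Y f => nt_natural r f)); split=> // X.
(* the underlying functors and units agree by computation; only the
   multiplications differ, by evaluation on T X against mu *)
rewrite [LHS]r_mult.
have /= e := f_equal (fun f : ahom _ _ => ahom_map f) (counit_free hT X).
by rewrite /= /adj_mu_c /= e.
Qed.
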